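(* Let $k$ be a positive integer and consider the $k$-th order system of two rational difference equations $$x_n=\frac{\alpha+\sum^{k}_{i=1}\beta_{i}x_{n-i} + \sum^{k}_{i=1}\gamma_{i}y_{n-i}}{A+\sum^{k}_{j=1}B_{j}x_{n-j} + \sum^{k}_{j=1}C_{j}y_{n-j}},\qquad y_n=\frac{p+\sum^{k}_{i=1}\delta_{i}x_{n-i} + \sum^{k}_{i=1}\epsilon_{i}y_{n-i}}{q+\sum^{k}_{j=1}D_{j}x_{n-j} + \sum^{k}_{j=1}E_{j}y_{n-j}},\qquad n\in\mathbb{N},$$ with non-negative real parameters and non-negative initial conditions. Assume that there exist $M_1>0$ and $M_2\ge 0$ such that every solution satisfies $y_n\le M_1x_n+M_2$ for all $n\in\mathbb{N}$. Assume further that $A>0$ and that there exists a positive integer $\eta$ such that for every sequence $\{c_m\}_{m=1}^\infty$ with $c_m\in I_\beta\cup(I_\gamma\setminus I_C)$ for all $m\ge 1$ there exist positive integers $N_1,N_2\le\eta$ such that $\sum_{m=N_1}^{N_2}c_m\in I_B$. Then there exist $M>0$ and $N\in\mathbb{N}$ such that every solution (from any non-negative initial conditions) satisfies $x_n\le M$ and $y_n\le M$ for all $n>N$.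
   Context: $\mathbb{N}=\{1,2,\dots\}$. Initial conditions are $x_{1-k},\dots,x_0,y_{1-k},\dots,y_0\ge 0$; a solution is a pair of sequences generated by the system from non-negative initial conditions for which all denominators are positive for every $n\in\mathbb{N}$. Index sets in $\{1,\dots,k\}$: $I_\beta=\{i:\beta_i>0\}$, $I_\gamma=\{i:\gamma_i>0\}$, $I_B=\{j:B_j>0\}$, $I_C=\{j:C_j>0\}$. A sum $\sum_{m=N_1}^{N_2}$ with $N_1>N_2$ is empty and equals $0$. *)

(* Defs.v *)
From mathcomp Require Import all_boot all_order all_algebra.
From mathcomp Require Import reals.

Set Implicit Arguments.
Unset Strict Implicit.
Unset Printing Implicit Defensive.

Import Order.TTheory GRing.Theory Num.Theory.
Local Open Scope ring_scope.

(* Coefficient families are functions on nat of which only the values at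
   1, ..., k are used; sequences are functions on int of which only the values
   at indices >= 1 - k are used. *)

Definition nonneg_coefs (R : realType) (k : nat) (b : nat -> R) : Prop :=
  forall i : nat, (1 <= i <= k)%N -> 0 <= b i.

Definition pos_idx (R : realType) (k : nat) (b : nat -> R) : pred nat :=
  [pred i : nat | (1 <= i <= k)%N && (0 < b i)].

Definition affine_form (R : realType) (k : nat) (a : R) (b c : nat -> R)
    (x y : int -> R) (n : nat) : R :=
  a + \sum_(1 <= i < k.+1) b i * x (n%:Z - i%:Z)
    + \sum_(1 <= i < k.+1) c i * y (n%:Z - i%:Z).

Definition is_solution (R : realType) (k : nat)
    (alpha : R) (beta gamma : nat -> R) (A : R) (B C : nat -> R)
    (p : R) (delta epsilon : nat -> R) (q : R) (D E : nat -> R)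
    (x y : int -> R) : Prop :=
  (forall m : int, 1 - k%:Z <= m <= 0 -> 0 <= x m /\ 0 <= y m) /\
  (forall n : nat, (1 <= n)%N ->
     [/\ 0 < affine_form k A B C x y n,
         0 < affine_form k q D E x y n,
         x n%:Z = affine_form k alpha beta gamma x y n
                  / affine_form k A B C x y n
       & y n%:Z = affine_form k p delta epsilon x y n
                  / affine_form k q D E x y n]).

(* Main.v *)
(* Let I be the union of I_beta and I_gamma \ I_C. Dividing term by term,
   x_n <= P + K W / denominator as soon as W bounds the x_{n-i} with i in I: the
   y-terms with index in I_C are absorbed by the denominator, the others are
   bounded through y <= M1 x + M2. Starting from n, go back repeatedly by the
   index c_m in I maximizing x_{t-i}. Each step forward on this path multiplies x + P by at
   most L, and among the first eta steps there are two path times whose distance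
   is some j in I_B. Between these the denominator contains B_j x at the earlier
   time, which cancels the growth, so x is bounded at the later one, and hence
   at n. *)
Require Import Defs.
From mathcomp Require Import all_boot all_order all_algebra.
From mathcomp Require Import reals.
From mathcomp Require Import zify ring lra.

Set Implicit Arguments.
Unset Strict Implicit.
Unset Printing Implicit Defensive.

Import Order.TTheory GRing.Theory Num.Theory.
Local Open Scope ring_scope.

Lemma le_affine_form (R : realType) (k : nat) (a : R) (b c : nat -> R)
    (x y : int -> R) (n j : nat) :
  nonneg_coefs k b -> nonneg_coefs k c ->
  (forall i, (1 <= i <= k)%N -> 0 <= x (n%:Z - i%:Z) /\ 0 <= y (n%:Z - i%:Z)) ->
  (1 <= j <= k)%N ->
  a + b j * x (n%:Z - j%:Z) + c j * y (n%:Z - j%:Z)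
    <= affine_form k a b c x y n.
Proof.
move=> hb hc hxy hj.
have hsum (f : nat -> R) : (forall i, (1 <= i <= k)%N -> 0 <= f i) ->
    f j <= \sum_(1 <= i < k.+1) f i.
  move=> hf; rewrite (bigD1_seq j) ?iota_uniq ?mem_index_iota //= lerDl.
  by rewrite big_seq_cond sumr_ge0 // => i; rewrite mem_index_iota => /andP[/hf].
rewrite /affine_form !lerD ?hsum // => i hi.
  by rewrite mulr_ge0 ?hb //; case: (hxy i hi).
by rewrite mulr_ge0 ?hc //; case: (hxy i hi).
Qed.

Lemma affine_form_ge0 (R : realType) (k : nat) (a : R) (b c : nat -> R)
    (x y : int -> R) (n : nat) :
  0 <= a -> nonneg_coefs k b -> nonneg_coefs k c ->
  (forall i, (1 <= i <= k)%N -> 0 <= x (n%:Z - i%:Z) /\ 0 <= y (n%:Z - i%:Z)) ->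
  0 <= affine_form k a b c x y n.
Proof.
move=> ha hb hc hxy; rewrite /affine_form !addr_ge0 //.
  rewrite big_nat sumr_ge0 // => i hi.
  by rewrite mulr_ge0 ?hb //; case: (hxy i hi).
rewrite big_nat sumr_ge0 // => i hi.
by rewrite mulr_ge0 ?hc //; case: (hxy i hi).
Qed.

Lemma solution_ge0 (R : realType) (k : nat) (alpha A p q : R)
    (beta gamma B C delta epsilon D E : nat -> R) (x y : int -> R) :
  0 <= alpha -> 0 <= p -> nonneg_coefs k beta -> nonneg_coefs k gamma ->
  nonneg_coefs k delta -> nonneg_coefs k epsilon ->
  is_solution k alpha beta gamma A B C p delta epsilon q D E x y ->
  forall m : int, 1 - k%:Z <= m -> 0 <= x m /\ 0 <= y m.
Proof.
move=> halpha hp hbeta hgamma hdelta hepsilon [hini hsol].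
(* Indices are integers from [1 - k] on, so the strong induction runs on a natural upper bound [n]
   of [m]. *)
suff hnat n m : m <= n%:Z -> 1 - k%:Z <= m -> 0 <= x m /\ 0 <= y m.
  by move=> m; apply: (hnat `|m|%N); lia.
elim: n m => [|n IHn] m hmn hkm; first by apply: hini; lia.
have [hm|hm] := lerP m n%:Z; first exact: IHn.
have {hm hmn hkm}-> : m = n.+1%:Z by lia.
have hprev i : (1 <= i <= k)%N ->
    0 <= x (n.+1%:Z - i%:Z) /\ 0 <= y (n.+1%:Z - i%:Z).
  by move=> hi; apply: IHn; lia.
have [// | hA hq -> ->] := hsol n.+1; have := (ltW hA, ltW hq).
by case=> hA0 hq0; split; apply: divr_ge0 => //; exact: affine_form_ge0.
Qed.

(** After clearing the denominator the inequality is checked index by index. The coefficient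
    [gamma i / C i] pays for y-terms dominated by the denominator, and is [0] when [C i = 0] since
    [0^-1 = 0]; [gamma i * M2 / A] pays for the constant [M2], because the denominator is at least
    [A]. *)
Lemma affine_form_quotient_le (R : realType) (k n : nat) (alpha A M1 M2 W : R)
    (beta gamma B C : nat -> R) (x y : int -> R) :
  0 <= alpha -> 0 < A -> 0 <= M1 -> 0 <= M2 -> 0 <= W ->
  nonneg_coefs k beta -> nonneg_coefs k gamma ->
  nonneg_coefs k B -> nonneg_coefs k C ->
  (forall i, (1 <= i <= k)%N ->
     [/\ 0 <= x (n%:Z - i%:Z), 0 <= y (n%:Z - i%:Z)
       & y (n%:Z - i%:Z) <= M1 * x (n%:Z - i%:Z) + M2]) ->
  (forall i, (i \in pos_idx k beta)
      || ((i \in pos_idx k gamma) && (i \notin pos_idx k C)) ->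
     x (n%:Z - i%:Z) <= W) ->
  affine_form k alpha beta gamma x y n / affine_form k A B C x y n
    <= alpha / A + \sum_(1 <= i < k.+1) (gamma i / C i + gamma i * M2 / A)
       + (\sum_(1 <= i < k.+1) (beta i + gamma i * M1)) * W
         / affine_form k A B C x y n.
Proof.
move=> halpha hA hM1 hM2 hW hbeta hgamma hB hC hxy hxW.
set den := affine_form k A B C x y n.
have hxy0 i : (1 <= i <= k)%N -> 0 <= x (n%:Z - i%:Z) /\ 0 <= y (n%:Z - i%:Z).
  by case/hxy.
have hAden : A <= den.
  have := @affine_form_ge0 R k 0 B C x y n (lexx _) hB hC hxy0.
  by rewrite /den /affine_form; lra.
have hden : 0 < den by exact: lt_le_trans hAden.
have scale a : 0 <= a -> a <= a / A * den.
  by move=> ha; rewrite mulrAC ler_pdivlMr // ler_wpM2l.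
rewrite ler_pdivrMr // [leRHS]mulrDl divfK ?gt_eqF // mulrDl !mulr_suml.
rewrite /affine_form -addrA -[leRHS]addrA lerD ?scale //.
rewrite -!big_split /= !big_nat ler_sum // => i hi.
have [hx hy hyx] := hxy i hi.
have hbi : beta i * x (n%:Z - i%:Z) <= beta i * W.
  have := hbeta i hi; rewrite le_eqVlt => /predU1P[<-|bi0].
    by rewrite !mul0r.
  by rewrite ler_wpM2l ?(ltW bi0) // hxW // inE /= hi bi0.
suff hgi : gamma i * y (n%:Z - i%:Z)
    <= (gamma i / C i + gamma i * M2 / A) * den + gamma i * M1 * W by lra.
have := hgamma i hi; rewrite le_eqVlt => /predU1P[<-|gi0].
  by rewrite !(mul0r, addr0).
have := hC i hi; rewrite le_eqVlt => /predU1P[Ci0|Ci0]; last first.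
  have hCy : C i * y (n%:Z - i%:Z) <= den.
    have := @le_affine_form R k A B C x y n i hB hC hxy0 hi.
    by have := mulr_ge0 (hB i hi) hx; rewrite -/den; lra.
  have h1 : gamma i * y (n%:Z - i%:Z) <= gamma i / C i * den.
    by rewrite -mulrA ler_wpM2l ?(ltW gi0) // mulrC ler_pdivlMr // mulrC.
  have h2 : 0 <= gamma i * M2 / A * den.
    by rewrite !mulr_ge0 ?invr_ge0 ?(ltW gi0) ?(ltW hA) ?(ltW hden).
  have h3 : 0 <= gamma i * M1 * W by rewrite !mulr_ge0 ?(ltW gi0).
  lra.
have hxi : x (n%:Z - i%:Z) <= W.
  by apply: hxW; rewrite !inE /= hi gi0 -Ci0 ltxx orbT.
rewrite -Ci0 invr0 mulr0 add0r.
have h1 : gamma i * M2 <= gamma i * M2 / A * den.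
  by rewrite scale // mulr_ge0 // ltW.
have h2 : gamma i * y (n%:Z - i%:Z) <= gamma i * (M1 * W + M2).
  rewrite ler_wpM2l ?(ltW gi0) // (le_trans hyx) // lerD2r.
  by rewrite ler_wpM2l.
lra.
Qed.

(** The descent for a single sequence, detached from the system. [M] is chosen before [x], which
    makes the bound uniform over solutions. Truncated subtraction is harmless, as steps back start
    from times above [k]. *)
Lemma backward_path_bound (R : realType) (k eta : nat) (I : pred nat)
    (P K A : R) (B : nat -> R) :
  0 <= P -> 0 <= K -> 0 < A -> nonneg_coefs k B ->
  {subset I <= [pred i | (1 <= i <= k)%N]} ->
  (forall c : nat -> nat, (forall m, (1 <= m)%N -> c m \in I) ->
     exists N1 N2, [/\ (1 <= N1 <= eta)%N, (1 <= N2 <= eta)%N &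
       (\sum_(N1 <= m < N2.+1) c m)%N \in pos_idx k B]) ->
  exists M : R, forall x : nat -> R,
    (forall n, 0 <= x n) ->
    (forall n i, (k < n)%N -> i \in I ->
       {in I, forall i', x (n - i')%N <= x (n - i)%N} ->
       x n <= P + K / A * x (n - i)%N /\
       {in pos_idx k B, forall j, x n <= P + K * x (n - i)%N / (A + B j * x (n - j)%N)}) ->
    forall n i, i \in I -> (k * eta.+1 < n)%N -> x n <= M.
Proof.
move=> hP hK hA hB hI hpath.
(* [L] is large enough that [P + K / A * u + P <= L * (u + P)] for [u >= 0]. *)
pose L := 2 + K / A.
(* Summing over all [j] makes [Q] independent of the index in I_B that the path will produce; a zero
   [B j] contributes [0]. *)
pose Q := P / A + \sum_(1 <= j < k.+1) (B j)^-1.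
exists (L ^+ eta * (2 * P + K * L ^+ eta * Q)).
move=> x hx hstep n i0 hi0 hn.
have hKA : 0 <= K / A by rewrite divr_ge0 // ltW.
have hL : 1 <= L by rewrite /L; lra.
have hL0 : 0 <= L by lra.
(* The index [i0] shows that [I] is inhabited, so a maximum over this finite set exists. *)
have max_exists t : exists i, i \in I /\ {in I, forall i', x (t - i')%N <= x (t - i)%N}.
  have hpred : exists i : 'I_k.+1, (i : nat) \in I.
    have hi : (i0 < k.+1)%N by have := hI _ hi0; rewrite inE /= ltnS; case/andP.
    by exists (Ordinal hi).
  case: hpred => j0 hj0.
  have [i hi imax] := @arg_maxP _ R _ j0 (fun i : 'I_k.+1 => (i : nat) \in I)
    (fun i : 'I_k.+1 => x (t - i)%N) hj0.
  exists i; split=> // i' hi'.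
  have hlt : (i' < k.+1)%N by have := hI _ hi'; rewrite inE /= ltnS; case/andP.
  exact: (imax (Ordinal hlt)).
have [f hf] := boolp.choice max_exists.
pose t m := iter m (fun s => s - f s)%N n.
have tS m : t m.+1 = (t m - f (t m))%N by [].
have fI s : f s \in I by case: (hf s).
have fk s : (1 <= f s <= k)%N by exact: hI.
(* Each step goes back by at most [k], so starting above [k * eta.+1] leaves room for [eta]
   steps. *)
have tlarge m : (m <= eta)%N -> (k < t m)%N.
  move=> hm; have : (n <= t m + k * m)%N.
    elim: m {hm} => [|m IHm]; first by rewrite muln0 addn0.
    by rewrite tS mulnS; have := fk (t m); move: IHm; clear; lia.
  have : (k * m <= k * eta)%N by rewrite leq_mul2l hm orbT.
  by move: hn; rewrite mulnS; clear; lia.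
(* Adding [P] turns the affine one-step bound into a purely multiplicative one. *)
have growth a d : (a + d <= eta.+1)%N -> x (t a) + P <= L ^+ d * (x (t (a + d)%N) + P).
  elim: d => [|d IHd] had; first by rewrite addn0 expr0 mul1r.
  apply: (le_trans (IHd _)); first by clear -had; lia.
  rewrite exprSr -mulrA ler_wpM2l ?exprn_ge0 // addnS tS.
  have hk : (k < t (a + d)%N)%N by apply: tlarge; clear -had; lia.
  have [h1 h2] := hf (t (a + d)%N).
  have [+ _] := hstep _ _ hk h1 h2.
  have := hx (t (a + d) - f (t (a + d)))%N.
  have : 0 <= K / A * P by rewrite mulr_ge0.
  by rewrite /L; lra.
have growth_eta a b : (a <= b <= eta)%N ->
    x (t a) + P <= L ^+ eta * (x (t b) + P).
  case/andP=> hab hb; have := growth a (b - a)%N; rewrite subnKC // => h.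
  apply: le_trans (h _) _; first by clear -hab hb; lia.
  by rewrite ler_wpM2r ?addr_ge0 // ler_weXn2l //; clear -hab hb; lia.
(* Step number [m >= 1] leaves from time [t m.-1], hence the predecessor. *)
have [|N1 [N2 [hN1 hN2 hsum]]] := hpath (fun m => f (t m.-1)).
  by move=> m _; exact: fI.
move: hsum; set j := (\sum_(_ <= m < _) _)%N => hj.
have := hj; rewrite inE /= => /andP[hjk Bj0].
(* An empty sum would be [0], which is not an index in I_B. *)
have hN : (N1 <= N2)%N.
  by case: leqP => // hN; move: hjk; rewrite /j big_geq.
(* The steps [N1] to [N2] telescope, so [j] is the distance between two path times. *)
have hjt : t N2 = (t N1.-1 - j)%N.
  have tsum a d : (t (a + d) = t a - \sum_(a.+1 <= m < (a + d).+1) f (t m.-1))%N.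
    elim: d => [|d IHd]; first by rewrite addn0 big_geq ?subn0.
    rewrite [in RHS]addnS big_nat_recr /=; last by rewrite ltnS leq_addr.
    by rewrite [in LHS]addnS tS IHd subnDA.
  have := tsum N1.-1 (N2 - N1.-1)%N.
  have -> : (N1.-1 + (N2 - N1.-1) = N2)%N by clear -hN; lia.
  by rewrite prednK //; case/andP: hN1.
have hk1 : (k < t N1.-1)%N by apply: tlarge; clear -hN1; lia.
have [h1 h2] := hf (t N1.-1).
have [_ /(_ j hj)] := hstep _ _ hk1 h1 h2.
rewrite -hjt -tS prednK; last by case/andP: hN1.
set z := x (t N2) => hx1.
have hz : 0 <= z by exact: hx.
have hden : 0 < A + B j * z by rewrite ltr_wpDr // mulr_ge0 // ltW.
(* In the product, [(B j)^-1] reproduces [z] and [P / A] reproduces [P]; the cross terms are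
   non-negative. *)
have hQ : z + P <= Q * (A + B j * z).
  have hBQ : P / A + (B j)^-1 <= Q.
    rewrite /Q lerD2l (bigD1_seq j) ?iota_uniq ?mem_index_iota //= lerDl.
    rewrite big_seq_cond sumr_ge0 // => i; rewrite mem_index_iota => /andP[hi _].
    by rewrite invr_ge0 hB.
  apply: le_trans (ler_wpM2r (ltW hden) hBQ).
  have -> : (P / A + (B j)^-1) * (A + B j * z)
      = z + P + (A / B j + P * B j * z / A).
    by field; rewrite !gt_eqF.
  by rewrite lerDl addr_ge0 ?divr_ge0 ?mulr_ge0 ?(ltW hA) ?(ltW Bj0).
have hN2' : (N2 <= eta)%N by case/andP: hN2.
have hxN1 : x (t N1) <= L ^+ eta * (z + P).
  by have := growth_eta N1 N2; rewrite hN hN2' -/z => /(_ isT); lra.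
(* The numerator [x (t N1)] is at most a multiple of [z + P], which [hQ] cancels against the
   denominator. *)
have hxpred : x (t N1.-1) <= P + K * L ^+ eta * Q.
  apply: (le_trans hx1); rewrite lerD2l ler_pdivrMr // -!mulrA ler_wpM2l //.
  by apply: (le_trans hxN1); rewrite ler_wpM2l ?exprn_ge0.
have hN1' : (N1.-1 <= eta)%N by case/andP: hN1 => _; exact: leq_trans (leq_pred _).
have hn0 : x n + P <= L ^+ eta * (x (t N1.-1) + P) .
  exact: (growth_eta 0%N N1.-1 hN1').
have hpred : L ^+ eta * (x (t N1.-1) + P)
    <= L ^+ eta * (2 * P + K * L ^+ eta * Q).
  by rewrite ler_wpM2l ?exprn_ge0 //; lra.
by lra.
Qed.

Theorem theorem16 (R : realType) (k : nat) (hk : (1 <= k)%N)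
  (alpha A p q : R) (beta gamma B C delta epsilon D E : nat -> R)
  (halpha : 0 <= alpha) (hA : 0 <= A) (hp : 0 <= p) (hq : 0 <= q)
  (hbeta : nonneg_coefs k beta) (hgamma : nonneg_coefs k gamma)
  (hB : nonneg_coefs k B) (hC : nonneg_coefs k C)
  (hdelta : nonneg_coefs k delta) (hepsilon : nonneg_coefs k epsilon)
  (hD : nonneg_coefs k D) (hE : nonneg_coefs k E)
  (hyx : exists M1 M2 : R, [/\ 0 < M1, 0 <= M2 &
     forall x y : int -> R,
       is_solution k alpha beta gamma A B C p delta epsilon q D E x y ->
       forall n : nat, (1 <= n)%N -> y n%:Z <= M1 * x n%:Z + M2])
  (hApos : 0 < A)
  (heta : exists eta : nat, (1 <= eta)%N /\
     forall c : nat -> nat,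
       (forall m : nat, (1 <= m)%N ->
          (c m \in pos_idx k beta)
          || ((c m \in pos_idx k gamma) && (c m \notin pos_idx k C))) ->
       exists N1 N2 : nat,
         [/\ (1 <= N1 <= eta)%N, (1 <= N2 <= eta)%N &
             (\sum_(N1 <= m < N2.+1) c m)%N \in pos_idx k B]) :
  exists (M : R) (N : nat), [/\ 0 < M, (1 <= N)%N &
    forall x y : int -> R,
      is_solution k alpha beta gamma A B C p delta epsilon q D E x y ->
      forall n : nat, (N < n)%N -> x n%:Z <= M /\ y n%:Z <= M].
Proof.
have [M1 [M2 [hM1 hM2 hy]]] := hyx.
have [eta [_ hpath]] := heta.
pose I : pred nat := [pred i | (i \in pos_idx k beta)
  || ((i \in pos_idx k gamma) && (i \notin pos_idx k C))].
pose P := alpha / A + \sum_(1 <= i < k.+1) (gamma i / C i + gamma i * M2 / A).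
pose K := \sum_(1 <= i < k.+1) (beta i + gamma i * M1).
have hP : 0 <= P.
  rewrite /P addr_ge0 ?divr_ge0 // big_nat sumr_ge0 // => i hi.
  by rewrite addr_ge0 ?divr_ge0 ?mulr_ge0 ?hgamma ?hC.
have hK : 0 <= K.
  rewrite /K big_nat sumr_ge0 // => i hi.
  by rewrite addr_ge0 ?mulr_ge0 ?hbeta ?hgamma // ltW.
have hIk : {subset I <= [pred i | (1 <= i <= k)%N]}.
  by move=> i; rewrite !inE => /orP[/andP[]//|/andP[/andP[]//]].
have [Mx hMx] := backward_path_bound hP hK hApos hB hIk hpath.
(* [Mx] serves when [I] is non-empty, and [P] alone when it is empty. *)
pose M := Num.max P Mx.
(* The summand [1] gives positivity, [|M|] bounds x, and the last bracket bounds y. *)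
exists (1 + `|M| + (M1 * `|M| + M2)), (k * eta.+1).+1.
split=> //; first by have := normr_ge0 M; have := mulr_ge0 (ltW hM1) (normr_ge0 M); lra.
move=> x y hsol n hn.
have hge0 := solution_ge0 halpha hp hbeta hgamma hdelta hepsilon hsol.
have hprev m : (1 <= m)%N -> forall i, (1 <= i <= k)%N ->
    0 <= x (m%:Z - i%:Z) /\ 0 <= y (m%:Z - i%:Z).
  by move=> hm i hi; apply: hge0; clear -hm hi; lia.
(* With [k < m] all the times [m - i] are at least [1], where y <= M1 x + M2 is available. *)
have hquot m W : (k < m)%N -> 0 <= W ->
    {in I, forall i, x (m - i)%N <= W} ->
    x m%:Z <= P + K * W / affine_form k A B C x y m.
  move=> hm hW hxW; have [|_ _ -> _] := hsol.2 m; first exact: leq_ltn_trans hm.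
  apply: affine_form_quotient_le => //; rewrite ?(ltW hM1) //.
    move=> i hi; have [hx0 hy0] := hprev m (leq_ltn_trans (leq0n _) hm) i hi.
    split=> //; rewrite subzn; last by clear -hm hi; lia.
    by apply: (hy x y hsol); clear -hm hi; lia.
  move=> i hi; have := hIk i hi; rewrite inE /= => hik.
  by rewrite subzn; [exact: hxW | clear -hm hik; lia].
have hxM : x n%:Z <= M.
  rewrite /M le_max.
  have [/existsP[i hi]|/existsPn hnI] := boolP [exists i : 'I_k.+1, (i : nat) \in I].
    apply/orP; right; apply: (hMx (fun m : nat => x m%:Z)) hi _; last by clear -hn; lia.
      by move=> m; have [] := hge0 m%:Z; first by clear -hk; lia.
    move=> m i' hm hi' hmax.
    have hm1 : (1 <= m)%N by exact: leq_ltn_trans hm.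
    have hW : 0 <= x (m - i')%N%:Z by have [] := hge0 (m - i')%N%:Z; first by clear -hk; lia.
    have hle := hquot m _ hm hW hmax.
    have hdenj j : (1 <= j <= k)%N ->
        A + B j * x (m - j)%N <= affine_form k A B C x y m.
      move=> hj; apply: le_trans (le_affine_form A hB hC (hprev m hm1) hj).
      have [_ hyj] := hprev m hm1 j hj.
      by rewrite -subzn; [rewrite lerDl mulr_ge0 ?hC | clear -hm hj; lia].
    have hbound d : 0 < d -> d <= affine_form k A B C x y m ->
        x m%:Z <= P + K * x (m - i')%N%:Z / d.
      move=> hd hdle; apply: (le_trans hle); rewrite lerD2l ler_wpM2l ?mulr_ge0 //.
      by rewrite lef_pV2 // posrE // (lt_le_trans hd).
    have hBx j : (1 <= j <= k)%N -> 0 <= B j * x (m - j)%N.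
      by move=> hj; rewrite mulr_ge0 ?hB //; have [] := hge0 (m - j)%N%:Z; first by clear -hk; lia.
    split.
      (* The denominator is at least [A], seen from [hdenj] at the index [1 <= k]. *)
      rewrite mulrAC; apply: hbound => //; apply: le_trans (hdenj 1%N _); last by rewrite hk.
      by rewrite lerDl hBx ?hk.
    move=> j; rewrite inE => /andP[hj _].
    by apply: hbound (hdenj j hj); rewrite ltr_wpDr ?hBx.
  (* With [I] empty, [W = 0] is admissible and only [P] remains. *)
  apply/orP; left; have := hquot n 0; rewrite mulr0 mul0r addr0; apply=> //.
    by move: hn; rewrite mulnS; clear; lia.
  move=> i hi; have := hIk i hi; rewrite inE /= => hik.
  have hlt : (i < k.+1)%N by clear -hik; lia.
  by have := hnI (Ordinal hlt); rewrite hi.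
have hxN : x n%:Z <= `|M| := le_trans hxM (ler_norm M).
have hyn : y n%:Z <= M1 * x n%:Z + M2 by apply: (hy x y hsol); clear -hn; lia.
have hMx1 := ler_wpM2l (ltW hM1) hxN.
have := mulr_ge0 (ltW hM1) (normr_ge0 M); have := normr_ge0 M.
by split; lra.
Qed.
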